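(* Let $\mathsf a=(\mathsf a_{\ell,\ell'})_{\ell,\ell'\ge0}$, $\mathsf b=(\mathsf b_\ell)_{\ell\ge0}$, $\mathsf d=(\mathsf d_{\ell,\ell'})_{\ell,\ell'\ge0}$, $\mathsf e=(\mathsf e_\ell)_{\ell\ge0}$ be indeterminates, and for $n\ge0$ define $$B_n(\mathsf a,\mathsf b,\mathsf d,\mathsf e)=\sum_{\pi\in\Pi_n}\;\prod_{i\in\mathrm{openers}}\mathsf a_{\mathrm{cr}(i,\pi),\,\mathrm{ne}(i,\pi)}\prod_{i\in\mathrm{closers}}\mathsf b_{\mathrm{qne}(i,\pi)}\prod_{i\in\mathrm{insiders}}\mathsf d_{\mathrm{cr}(i,\pi),\,\mathrm{ne}(i,\pi)}\prod_{i\in\mathrm{singletons}}\mathsf e_{\mathrm{qne}(i,\pi)}.$$ Then $$\sum_{n=0}^\infty B_n(\mathsf a,\mathsf b,\mathsf d,\mathsf e)\,t^n=\cfrac{1}{1-\gamma_0 t-\cfrac{\beta_1t^2}{1-\gamma_1t-\cfrac{\beta_2t^2}{1-\gamma_2 t-\cdots}}}$$ with coefficients $$\gamma_n=\mathsf d^\star_{n-1}+\mathsf e_n\quad(n\ge0),\qquad\beta_n=\mathsf a^\star_{n-1}\,\mathsf b_{n-1}\quad(n\ge1),$$ where $\mathsf a^\star_{n-1}=\sum_{\ell=0}^{n-1}\mathsf a_{\ell,n-1-\ell}$ and likewise for $\mathsf d$ (so $\mathsf d^\star_{-1}=0$).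
   Context: $\Pi_n$ is the set of partitions of $[n]=\{1,\dots,n\}$ into nonempty blocks. Continued fractions are identities of formal power series in $t$. For $\pi\in\Pi_n$, an element $i\in[n]$ is an opener if it is the smallest element of a block of size $\ge2$; a closer if it is the largest element of a block of size $\ge2$; an insider if it is a non-opener non-closer element of a block of size $\ge3$; a singleton if it is the sole element of a block of size 1. $\mathcal G_\pi$ is the graph on vertex set $[n]$ whose edges join consecutive elements within the same block; edges are written $(i,j)$ with $i<j$. For $j\in[n]$ define $\mathrm{cr}(j,\pi)=\#\{i<j<k<l:\ (i,k)\in\mathcal G_\pi,\ (j,l)\in\mathcal G_\pi\}$, $\mathrm{ne}(j,\pi)=\#\{i<j<k<l:\ (i,l)\in\mathcal G_\pi,\ (j,k)\in\mathcal G_\pi\}$, $\mathrm{qne}(j,\pi)=\#\{i<j<l:\ (i,l)\in\mathcal G_\pi\}$ (in each case $j$ is fixed and the other indices vary). *)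

(* Defs.v *)
From mathcomp Require Import all_boot all_order all_algebra.

Set Implicit Arguments.
Unset Strict Implicit.
Unset Printing Implicit Defensive.

Import GRing.Theory.
Local Open Scope ring_scope.

Section FormalPowerSeries.

Variable R : comNzRingType.

(* f : fps stands for \sum_n (f n) t^n. *)
Definition fps := nat -> R.

Implicit Types f g : fps.

(* c t^k *)
Definition fps_monom (c : R) (k : nat) : fps :=
  fun n => if n == k then c else 0.
Definition fps_one : fps := fps_monom 1 0.
Definition fps_sub f g : fps := fun n => f n - g n.
Definition fps_mul f g : fps := fun n => \sum_(i < n.+1) f i * g (n - i)%N.
Definition fps_exp f (k : nat) : fps := iter k (fps_mul f) fps_one.

(* 1 / f = \sum_k (1 - f)^k, for f with constant term 1; the k-th power has no
   term of degree less than k, so the coefficient of t^n only involves k <= n. *)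
Definition fps_inv f : fps :=
  fun n => \sum_(k < n.+1) fps_exp (fps_sub fps_one f) k n.

Lemma fps_exp_small f k n : f 0%N = 0 -> (n < k)%N -> fps_exp f k n = 0.
Proof.
move=> f0; elim: k n => [//|k IHk] n ltnk.
rewrite /fps_exp iterS -/(fps_exp f k) /fps_mul big1 // => -[[|i] lti] _ /=.
  by rewrite f0 mul0r.
rewrite IHk ?mulr0 //.
have n_gt0 : (0 < n)%N by case: (n) lti.
by rewrite -ltnS (leq_trans _ ltnk) // ltnS ltn_subrL n_gt0.
Qed.

Lemma fps_mulV f : f 0%N = 1 -> fps_mul f (fps_inv f) =1 fps_one.
Proof.
move=> f0 n; set h := fps_sub fps_one f.
have h0 : h 0%N = 0 by rewrite /h /fps_sub /fps_one /fps_monom f0 subrr.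
have invE m : (m <= n)%N -> fps_inv f m = \sum_(k < n.+1) fps_exp h k m.
  move=> lemn; rewrite /fps_inv -/h.
  rewrite -!(big_mkord xpredT (fun k => fps_exp h k m)).
  rewrite [RHS](@big_cat_nat _ _ _ m.+1) //= [X in _ = _ + X]big_nat_cond.
  by rewrite [X in _ = _ + X]big1 ?addr0 // => k /andP[/andP[ltmk _] _];
     apply: fps_exp_small.
have step k : fps_mul f (fps_exp h k) n = fps_exp h k n - fps_exp h k.+1 n.
  rewrite {3}/fps_exp iterS -/(fps_exp h k) /fps_mul.
  have -> : fps_exp h k n = \sum_(i < n.+1) fps_one i * fps_exp h k (n - i)%N.
    rewrite big_ord_recl /= subn0 mul1r big1 ?addr0 // => i _.
    by rewrite /fps_one /fps_monom /= mul0r.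
  rewrite -sumrB; apply: eq_bigr => i _.
  by rewrite -mulrBl /h /fps_sub opprB addrC subrK.
rewrite {1}/fps_mul.
under eq_bigr => i _ do rewrite invE ?leq_subr // mulr_sumr.
rewrite exchange_big /=.
under eq_bigr => k _ do rewrite -/(fps_mul f (fps_exp h k) n) step.
rewrite -(big_mkord xpredT (fun k => fps_exp h k n - fps_exp h k.+1 n)).
under eq_bigr => k _ do rewrite -opprB.
rewrite sumrN telescope_sumr // opprB.
by rewrite (@fps_exp_small h n.+1 n) // subr0.
Qed.

(* t-adic convergence: each coefficient is eventually constant. *)
Definition fps_cvg (F : nat -> fps) (f : fps) : Prop :=
  forall n, exists K, forall k, (K <= k)%N -> F k n = f n.

(* The convergent with k levels of the J-fraction with coefficients
   gamma_m, gamma_(m+1), ... and beta_(m+1), beta_(m+2), ... *)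
Fixpoint jfrac_convergent (gamma beta : nat -> R) (k m : nat) : fps :=
  if k is k'.+1 then
    fps_inv
      (fps_sub (fps_sub fps_one (fps_monom (gamma m) 1))
               (fps_mul (fps_monom (beta m.+1) 2)
                        (jfrac_convergent gamma beta k' m.+1)))
  else fun=> 0.

(* f = 1/(1 - gamma_0 t - beta_1 t^2/(1 - gamma_1 t - beta_2 t^2/(1 - ...)));
   the value beta 0 is not used. *)
Definition is_jfraction (gamma beta : nat -> R) (f : fps) : Prop :=
  fps_cvg (fun k => jfrac_convergent gamma beta k 0) f.

End FormalPowerSeries.

(* Set partitions of [n] are P : {set {set 'I_n}} with partition P [set: 'I_n];
   the ordinal of value i stands for the element i + 1 of [n]. *)
Section SetPartitions.

Variables (n : nat) (P : {set {set 'I_n}}).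

Implicit Types i j k l : 'I_n.

Definition opener i : bool :=
  [exists B in P, [&& i \in B, (2 <= #|B|)%N & [forall j in B, (i <= j)%N]]].

Definition closer i : bool :=
  [exists B in P, [&& i \in B, (2 <= #|B|)%N & [forall j in B, (j <= i)%N]]].

Definition insider i : bool :=
  [&& ~~ opener i, ~~ closer i & [exists B in P, (i \in B) && (3 <= #|B|)%N]].

Definition singleton i : bool :=
  [exists B in P, (i \in B) && (#|B| == 1%N)].

(* i < j are consecutive elements of a same block. *)
Definition edge i j : bool :=
  [exists B in P, [&& i \in B, j \in B, (i < j)%N &
                      [forall k in B, ~~ ((i < k)%N && (k < j)%N)]]].

Definition cr j : nat :=
  #|[set x : 'I_n * 'I_n * 'I_n | let: (i, k, l) := x in
      [&& (i < j)%N, (j < k)%N, (k < l)%N, edge i k & edge j l]]|.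

Definition ne j : nat :=
  #|[set x : 'I_n * 'I_n * 'I_n | let: (i, k, l) := x in
      [&& (i < j)%N, (j < k)%N, (k < l)%N, edge i l & edge j k]]|.

Definition qne j : nat :=
  #|[set x : 'I_n * 'I_n | let: (i, l) := x in
      [&& (i < j)%N, (j < l)%N & edge i l]]|.

End SetPartitions.

Section GeneratingPolynomials.

Variable R : comNzRingType.

Definition Bpoly (a : nat -> nat -> R) (b : nat -> R)
    (d : nat -> nat -> R) (e : nat -> R) (n : nat) : R :=
  \sum_(P : {set {set 'I_n}} | partition P [set: 'I_n])
    (\prod_(i | opener P i) a (cr P i) (ne P i)) *
    (\prod_(i | closer P i) b (qne P i)) *
    (\prod_(i | insider P i) d (cr P i) (ne P i)) *
    (\prod_(i | singleton P i) e (qne P i)).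

(* star_pred x n is x^star_(n-1); in particular it is 0 for n = 0. *)
Definition star_pred (x : nat -> nat -> R) (n : nat) : R :=
  \sum_(l < n) x l (n.-1 - l)%N.

End GeneratingPolynomials.

(* Main.v *)
Require Import Defs.
From mathcomp Require Import all_boot all_order all_algebra.
From mathcomp Require Import zify ring.

Set Implicit Arguments.
Unset Strict Implicit.
Unset Printing Implicit Defensive.

Import GRing.Theory.
Local Open Scope ring_scope.

(** Read a set partition of [n] from the right to the left.  When the vertex i
    is reached, some of the vertices already read still wait for their
    predecessor in their block; let h be their number.  The kind of the vertex i
    decides how h changes: an opener takes one waiting vertex as its successor
    and disappears itself, a closer starts to wait, an insider does both, a
    singleton neither.  The arcs which pass over i are those which will end at
    the waiting vertices, apart from the successor l of i if there is one.  An
    arc over i that ends before l crosses the arc (i, l), and one that ends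
    after l is nested around it.  So if h vertices wait and i takes the one of
    rank r among them, counted from 0, then cr(i) = r and ne(i) = h - 1 - r: summing over the
    choice of l gives exactly a*_(h-1) or d*_(h-1), while qne(i) is the number
    of waiting vertices and depends on no choice.  Hence the weighted sum over
    partitions is a sum over Motzkin paths with a level step weight
    d*_(h-1) + e_h at height h and with weights whose product over the two
    steps between the heights h and h + 1 is a*_h b_h; and such sums are
    given by a J-fraction, by decomposition at the first return to the ground.

    The intermediate objects are the partitions of the last n vertices together
    with the mark of the waiting ones, called diagrams below.  A diagram maps
    each vertex to its predecessor, where a waiting vertex has an undetermined
    predecessor further to the left.  The proof rests on four facts:
    [diagram_sumS], the removal of the first vertex of a diagram, which shows
    that the weighted sums of diagrams satisfy the recurrence of Motzkin paths;
    [sum_below_above], the summation over the rank of the successor;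
    [motzkin_jfraction], the continued fraction of Motzkin paths; and
    [Bpoly_diagram_sum], by which set partitions are the diagrams in which no
    vertex waits, with the same weights. *)

(** * Weighted Motzkin paths *)

Section Motzkin.
Variables (R : comNzRingType) (g u w : nat -> R).

(** Weight of the paths of n steps from height s + h down to height s that never
    go below s; level steps at height m weigh g m, and the steps up from m and
    down to m weigh u m and w m.  The floor s is a parameter because the
    continued fraction relates the floors s and s + 1. *)
Fixpoint motzkin (s n h : nat) : R :=
  if n is n'.+1 then
    g (s + h)%N * motzkin s n' h + u (s + h)%N * motzkin s n' h.+1
    + (if h is h'.+1 then w (s + h')%N * motzkin s n' h' else 0)
  else (h == 0%N)%:R.

(** A path from s + h + 1 to s first reaches s by one step down from s + 1.
    Before this step it is a path above the floor s + 1, of length i; after it,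
    it is any path from s to s. *)
Lemma motzkin_first_passage s n h :
  motzkin s n h.+1 =
  w s * \sum_(i < n) motzkin s.+1 i h * motzkin s (n.-1 - i) 0.
Proof.
elim: n h => [|n IHn] h; first by rewrite big_ord0 mulr0.
rewrite big_ord_recl subn0 mulrDr {1}[motzkin]lock /= -lock.
have -> : \sum_(i < n) motzkin s.+1 (bump 0 i) h * motzkin s (n - bump 0 i) 0 =
  g (s + h.+1)%N * \sum_(i < n) motzkin s.+1 i h * motzkin s (n.-1 - i) 0
  + u (s + h.+1)%N * \sum_(i < n) motzkin s.+1 i h.+1 * motzkin s (n.-1 - i) 0
  + (if h is h'.+1 then w (s + h)%N *
       \sum_(i < n) motzkin s.+1 i h' * motzkin s (n.-1 - i) 0 else 0).
  case: h => [|h]; rewrite ?addr0 !mulr_sumr -!big_split /=;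
    apply: eq_bigr => i _;
    rewrite /bump add1n /= !addSn !addnS ?addSn subnS -predn_sub /=; ring.
rewrite {1}/motzkin -/motzkin !IHn.
case: h => [|h] /=; last by rewrite IHn; ring.
by rewrite addn0; ring.
Qed.

(** This is J_s = 1 + g_s t J_s + u_s w_s t^2 J_(s+1) J_s, coefficient by
    coefficient, where J_s is the generating function of the paths from s to s
    above s. *)
Lemma motzkin_base s n :
  motzkin s n 0 = fps_one R n
    + (if n is n'.+1 then g s * motzkin s n' 0 else 0)
    + (if n is n'.+2 then u s * w s *
         \sum_(i < n'.+1) motzkin s.+1 i 0 * motzkin s (n' - i) 0 else 0).
Proof.
case: n => [|n] /=; first by rewrite !addr0.
rewrite addn0 motzkin_first_passage addr0 add0r.
by case: n => [|n] /=; rewrite ?big_ord0 ?mulr0 // mulrA.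
Qed.

End Motzkin.

(** * Continued fractions *)

Section Fractions.
Variable R : comNzRingType.
Implicit Types f g : fps R.

Lemma fps_mul_monom (c : R) k f n :
  fps_mul (fps_monom c k) f n = if (k <= n)%N then c * f (n - k)%N else 0.
Proof.
rewrite /fps_mul /fps_monom; case: leqP => [lekn|ltnk].
  rewrite (bigD1 (Ordinal (lekn : (k < n.+1)%N))) //= eqxx big1 ?addr0 // => i.
  by rewrite -val_eqE /= => /negPf->; rewrite mul0r.
by rewrite big1 // => i _; rewrite ltn_eqF ?mul0r //;
  rewrite (leq_ltn_trans _ ltnk) // -ltnS.
Qed.

(** The coefficients of an inverse below degree N depend only on those of the
    series below degree N.  This turns the equation satisfied by the limit into
    an estimate for the convergents. *)
Lemma fps_inv_eq_upto f f' x N :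
    f 0%N = 1 -> (forall n, (n < N)%N -> f n = f' n) ->
    fps_mul f' x =1 fps_one R ->
  forall n, (n < N)%N -> fps_inv f n = x n.
Proof.
move=> f0 eqf xV n; elim/ltn_ind: n => n IHn ltnN.
have N0 : (0 < N)%N by apply: leq_trans ltnN.
have := fps_mulV f0 n; rewrite -xV /fps_mul !big_ord_recl /= subn0.
rewrite -(eqf 0%N) // f0 !mul1r.
rewrite (eq_bigr (fun i : 'I_n => f' (bump 0 i) * x (n - bump 0 i)%N)).
  exact: addIr.
move=> i _; rewrite /bump add1n eqf ?IHn //; have := ltn_ord i; lia.
Qed.

Variables g u w beta : nat -> R.
Hypothesis betaS : forall m, beta m.+1 = u m * w m.

(** A path of fewer than k steps stays below the height m + k, hence is counted
    by the convergent with k levels. *)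
Lemma jfrac_convergent_motzkin k m n :
  (n < k)%N -> jfrac_convergent g beta k m n = motzkin g u w m n 0.
Proof.
elim: k m n => [//|k IHk] m n ltnk /=.
pose den x := fps_sub (fps_sub (fps_one R) (fps_monom (g m) 1))
                      (fps_mul (fps_monom (beta m.+1) 2) x).
have denE x i : den x i = fps_one R i - fps_monom (g m) 1 i
    - (if (2 <= i)%N then beta m.+1 * x (i - 2)%N else 0).
  by rewrite /den /fps_sub fps_mul_monom.
pose mz i := motzkin g u w m i 0; rewrite -[RHS]/(mz n).
(* Replacing the tail of the fraction by the true series changes the
   denominator only from degree k + 2 on. *)
apply: (@fps_inv_eq_upto _ (den (fun i => motzkin g u w m.+1 i 0)) mz k.+1
          _ _ _ n ltnk).
- by rewrite -/(den _) denE /fps_one /fps_monom /= !subr0.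
- move=> i lti; rewrite -!/(den _) !denE; case: ifP => // le2i.
  by rewrite IHk //; lia.
move=> {n ltnk IHk} n; rewrite /fps_mul.
under eq_bigr => i _ do rewrite denE !mulrBl.
rewrite !sumrB.
rewrite -/(fps_mul (fps_one R) (fun j => motzkin g u w m j 0) n).
rewrite -/(fps_mul (fps_monom (g m) 1) (fun j => motzkin g u w m j 0) n).
rewrite !fps_mul_monom /= subn0 mul1r [X in X - _ - _]motzkin_base.
rewrite -/(mz n) -/(mz (n - 1)%N).
set mz' := fun i => motzkin g u w m.+1 i 0.
rewrite /fps_one /fps_monom; case: n => [|[|n]].
- by rewrite big_ord_recl big_ord0 /= mul0r; ring.
- by rewrite !big_ord_recl big_ord0 /= subnn (_ : mz 0%N = 1) //; ring.
rewrite subSS subn0 -/(mz n.+1) mulr_sumr.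
rewrite [X in _ - X = _]big_ord_recl [X in _ - (_ + X) = _]big_ord_recl.
rewrite /= !mul0r !add0r.
rewrite [X in _ - X = _](eq_bigr (fun i : 'I_n.+1 =>
    u m * w m * (mz' i * mz (n - i)%N))).
  by rewrite (addrC (g m * _)) addrK subrr.
by move=> i _; rewrite /bump !add1n !subSS subn0 betaS mulrA.
Qed.

Lemma motzkin_jfraction : is_jfraction g beta (fun n => motzkin g u w 0 n 0).
Proof. by move=> n; exists n.+1 => k ltnk; rewrite jfrac_convergent_motzkin. Qed.

End Fractions.

(** * Summation over the rank of an element *)

Section RankSum.
Variable R : comNzRingType.

Lemma sum_ord_recl_cond n (q : pred 'I_n.+1) (F : 'I_n.+1 -> R) :
  \sum_(l | q l) F l =
  (if q ord0 then F ord0 else 0) + \sum_(l | q (lift ord0 l)) F (lift ord0 l).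
Proof. by rewrite big_mkcond big_ord_recl -big_mkcond. Qed.

Lemma sum_option (T : finType) (P : pred (option T)) (F : option T -> R) :
  \sum_(o | P o) F o =
  (if P None then F None else 0) + \sum_(l | P (Some l)) F (Some l).
Proof.
rewrite big_mkcond (bigD1 None) //=; congr (_ + _).
rewrite (@reindex_omap _ _ _ _ _ Some id) => [|[]//].
by rewrite [RHS]big_mkcond; apply: eq_bigl => l; rewrite /= eqxx.
Qed.

(** If l is the element of rank r among the h elements that satisfy q, then r
    of them are below l and h - 1 - r above.  This is where the sums a* and d*
    come from. *)
Lemma sum_below_above n (q : pred 'I_n) (x : nat -> nat -> R) :
  \sum_(l | q l) x (\sum_(k < n) (q k && (k < l)%N))%N
                   (\sum_(k < n) (q k && (l < k)%N))%N =
  star_pred x (\sum_(k < n) q k)%N.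
Proof.
rewrite /star_pred; elim: n q x => [|n IHn] q x; first by rewrite !big_ord0.
rewrite sum_ord_recl_cond.
pose q' := q \o lift ord0.
(* Removing the first index shifts the rank of the others by q ord0. *)
pose x' r s := x (q ord0 + r)%N s.
rewrite [X in _ + X](_ : _ = \sum_(l | q' l)
    x' (\sum_(k < n) (q' k && (k < l)%N))%N (\sum_(k < n) (q' k && (l < k)%N))%N).
  have -> : (\sum_(k < n.+1) (q k && (k < @ord0 n)) = 0)%N.
    by rewrite big1 // => k _; rewrite ltn0 andbF.
  have -> : (\sum_(k < n.+1) (q k && (@ord0 n < k)) = \sum_(k < n) q' k)%N.
    rewrite big_ord_recl ltnn andbF add0n.
    by apply: eq_bigr => k _; rewrite lift0 andbT.
  rewrite IHn [in RHS]big_ord_recl /x'.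
  case: (q ord0); rewrite ?add0r ?add0n // add1n [in RHS]big_ord_recl subn0.
  congr (_ + _); apply: eq_bigr => i _; rewrite lift0 add1n /=; congr (x _ _).
  by rewrite -subn1 -subnDA.
apply: eq_bigr => l _; rewrite /x' !big_ord_recl lift0 ltn0 !andbF add0n andbT.
congr (x _ _).
Qed.

End RankSum.

Lemma pick_lift0 n (P : pred 'I_n.+1) :
  ~~ P ord0 -> [pick k | P k] = omap (lift ord0) [pick k | P (lift ord0 k)].
Proof.
move=> P0; rewrite /pick.
have enumE m (Q : pred 'I_m) : enum (fun k => Q k) = filter Q (enum 'I_m).
  by rewrite [enum 'I_m]enumT.
rewrite (enumE _ P) (enumE _ (fun k => P (lift ord0 k))) enum_ordSl /=.
by rewrite (negPf P0) filter_map; case: filter.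
Qed.

(** * Diagrams *)

(** The value at k is None if k is the least element of its block, Some (Some i)
    if the predecessor of k in its block is i, and Some None if k is dangling:
    its predecessor exists but lies to the left of all vertices.  Keeping the
    predecessors rather than the successors makes the arc from a removed first
    vertex turn into a dangling end. *)
Definition diagram n := {ffun 'I_n -> option (option 'I_n)}.

Section Diagram.
Variables (n : nat) (c : diagram n).

Definition dangling k := c k == Some None.
Definition link i k := c k == Some (Some i).
Definition target i := [pick k | link i k].
(** The arc that ends at k passes over i; a dangling one comes from the left of
    every vertex. *)
Definition covers (i k : 'I_n) :=
  (i < k)%N && (if c k is Some p then if p is Some j then (j < i)%N else true
                else false).

Definition ndangling := (\sum_k dangling k)%N.
Definition valid :=
  [forall i : 'I_n, forall k : 'I_n, link i k ==> (i < k)%N] &&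
  [forall i, forall k, forall l, link i k ==> link i l ==> (k == l)].
Definition crossings (i l : 'I_n) := (\sum_k (covers i k && (k < l)%N))%N.
Definition nestings (i l : 'I_n) := (\sum_k (covers i k && (l < k)%N))%N.
Definition coverings (i : 'I_n) := (\sum_k covers i k)%N.

Lemma validP : reflect
  [/\ forall i k : 'I_n, link i k -> (i < k)%N &
      forall i k l, link i k -> link i l -> k = l] valid.
Proof.
apply: (iffP andP) => -[].
  move=> /forallP v1 /forallP v2; split=> [i k|i k l].
    by move/forallP/(_ k)/implyP: (v1 i).
  move=> ik il; have /forallP/(_ k)/forallP/(_ l) := v2 i.
  by rewrite ik il => /eqP.
move=> v1 v2; split; first by apply/forallP=> i; apply/forallP=> k; exact/implyP/v1.
apply/forallP=> i; apply/forallP=> k; apply/forallP=> l.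
by apply/implyP => ik; apply/implyP => il; apply/eqP/(v2 i).
Qed.

End Diagram.

Section Weight.
Variables (R : comNzRingType) (a d : nat -> nat -> R) (b e : nat -> R).

Definition vertex_weight n (c : diagram n) i :=
  match c i, target c i with
  | None, Some l => a (crossings c i l) (nestings c i l)
  | Some _, None => b (coverings c i)
  | Some _, Some l => d (crossings c i l) (nestings c i l)
  | None, None => e (coverings c i)
  end.

Definition weight n (c : diagram n) := \prod_i vertex_weight c i.

(** The number h of dangling vertices is the height in the Motzkin path. *)
Definition diagram_sum n h :=
  \sum_(c : diagram n | valid c && (ndangling c == h)) weight c.

End Weight.

(** * Removing the first vertex *)

Section Attach.
Variable n : nat.
Implicit Types (c : diagram n.+1) (x : diagram n * (bool * option 'I_n)).

(** In (r, (v, o)), the diagram r lives on the vertices other than the first, v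
    says whether the new first vertex is dangling, and o is its successor, which
    must be a dangling vertex of r. *)
Definition attach x : diagram n.+1 := let: (r, (v, o)) := x in
  [ffun i => if unlift ord0 i is Some k then
     if o == Some k then Some (Some ord0) else omap (omap (lift ord0)) (r k)
   else if v then Some None else None].

Arguments attach : simpl never.

Definition detach c : diagram n * (bool * option 'I_n) :=
  ([ffun k => omap (obind (unlift ord0)) (c (lift ord0 k))],
   (dangling c ord0, [pick k | link c ord0 (lift ord0 k)])).

Definition attachable (r : diagram n) (o : option 'I_n) :=
  if o is Some l then dangling r l else true.

Lemma attach0 r v o : attach (r, (v, o)) ord0 = if v then Some None else None.
Proof. by rewrite ffunE unlift_none. Qed.

Lemma attachS r v o k : attach (r, (v, o)) (lift ord0 k) =
  if o == Some k then Some (Some ord0) else omap (omap (lift ord0)) (r k).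
Proof. by rewrite ffunE liftK. Qed.

Lemma link_attach0 x i : link (attach x) i ord0 = false.
Proof. by case: x => r [v o]; rewrite /link attach0; case: v. Qed.

Lemma link_attach0S r v o k :
  link (attach (r, (v, o))) ord0 (lift ord0 k) = (o == Some k).
Proof.
rewrite /link attachS; case: (o == Some k) => //.
by case: (r k) => [[j|]|].
Qed.

Lemma link_attachS r v o i k : attachable r o ->
  link (attach (r, (v, o))) (lift ord0 i) (lift ord0 k) = link r i k.
Proof.
rewrite /link attachS; case: (o =P Some k) => [-> /= /eqP->//|_ _].
by case: (r k) => [[j|]|] //=; rewrite -!(inj_eq val_inj).
Qed.

Lemma dangling_attach0 r v o : dangling (attach (r, (v, o))) ord0 = v.
Proof. by rewrite /dangling attach0; case: v. Qed.

Lemma dangling_attachS r v o k :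
  dangling (attach (r, (v, o))) (lift ord0 k) = dangling r k && (o != Some k).
Proof.
rewrite /dangling attachS; case: (o == Some k); rewrite ?andbF // andbT.
by case: (r k) => [[j|]|].
Qed.

Lemma ord0P (P : 'I_n.+1 -> Prop) :
  P ord0 -> (forall k, P (lift ord0 k)) -> forall i, P i.
Proof. by move=> P0 PS i; case: (unliftP ord0 i) => [k|] ->. Qed.

Lemma valid_attach r v o :
  valid r -> attachable r o -> valid (attach (r, (v, o))).
Proof.
move=> /validP[v1 v2] ok; apply/validP; split.
  elim/ord0P=> [|i]; elim/ord0P=> [|k]; rewrite ?link_attach0 // link_attachS //.
  exact: v1.
elim/ord0P=> [|i]; elim/ord0P=> [|k]; elim/ord0P=> [|l]; rewrite ?link_attach0 //.
  by rewrite !link_attach0S => /eqP-> /eqP[->].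
by rewrite !link_attachS // => ik il; rewrite (v2 i k l).
Qed.

Lemma detachK c : valid c -> attach (detach c) = c.
Proof.
move=> /validP[v1 v2]; apply/ffunP; elim/ord0P=> [|k].
  rewrite attach0 /dangling; case c0: (c ord0) => [[j|]|] //.
  by have := v1 j ord0; rewrite /link c0 eqxx => /(_ isT).
rewrite attachS; case: pickP => [l l0|no].
  have [[<-]|neq] := eqVneq (Some l) (Some k); first by rewrite (eqP l0).
  rewrite ffunE; case ck: (c (lift ord0 k)) => [[j|]|] //=.
  case: unliftP => [j' ->//|j0]; case/eqP: neq; congr Some.
  by apply: (@lift_inj _ ord0); apply: (v2 ord0) => //; rewrite /link ck j0.
rewrite ffunE; case ck: (c (lift ord0 k)) => [[j|]|] //=.
case: unliftP => [j' ->//|j0]; have := no k.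
by rewrite /link ck j0 eqxx.
Qed.

Lemma valid_detach c : valid c ->
  valid (detach c).1 /\ attachable (detach c).1 (detach c).2.2.
Proof.
move=> /validP[v1 v2].
have linkS i k : link (detach c).1 i k -> link c (lift ord0 i) (lift ord0 k).
  rewrite /link ffunE; case: (c (lift ord0 k)) => [[j|]|] //=.
  by case: unliftP => // j' -> /eqP[->].
split; last first.
  rewrite /detach /=; case: pickP => //= k /eqP k0.
  by rewrite /dangling ffunE k0 /= unlift_none.
apply/validP; split=> [i k /linkS/v1|i k l /linkS ik /linkS il].
  by rewrite !lift0.
exact/(@lift_inj _ ord0)/(v2 _ _ _ ik il).
Qed.

Lemma attachK r v o :
  attachable r o -> detach (attach (r, (v, o))) = (r, (v, o)).
Proof.
move=> ok; rewrite /detach; congr (_, (_, _)).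
- apply/ffunP=> k; rewrite ffunE attachS.
  case: (o =P Some k) ok => [-> /= /eqP->|_ _].
    by rewrite unlift_none.
  by case: (r k) => [[j|]|] //=; rewrite liftK.
- exact: dangling_attach0.
case: pickP => [k|no]; first by rewrite link_attach0S => /eqP->.
by case: o {ok} no => // l /(_ l); rewrite link_attach0S eqxx.
Qed.

(** Stated as a sum on both sides to avoid a truncated subtraction: the height
    changes by v minus the number of successors taken. *)
Lemma ndangling_attach r v o : attachable r o ->
  (ndangling (attach (r, (v, o))) + (o : bool) = v + ndangling r)%N.
Proof.
move=> ok; rewrite /ndangling big_ord_recl dangling_attach0 -addnA; congr (_ + _)%N.
rewrite (eq_bigr (fun k => dangling r k && (o != Some k) : nat)); last first.
  by move=> k _; rewrite dangling_attachS.
case: o ok => [l|] /= ok; last first.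
  by rewrite addn0; apply: eq_bigr => i _; rewrite andbT.
rewrite [RHS](bigD1 l) //= ok addnC; congr (_ + _)%N.
rewrite (bigD1 l) //= eqxx andbF add0n; apply: eq_bigr => k neq.
by rewrite (inj_eq Some_inj) eq_sym neq andbT.
Qed.

Lemma covers_attach0 r v o k :
  covers (attach (r, (v, o))) ord0 (lift ord0 k) = dangling r k && (o != Some k).
Proof.
rewrite /covers attachS /dangling lift0 /=.
case: (o == Some k); rewrite ?andbF // andbT.
by case: (r k) => [[j|]|].
Qed.

Lemma covers_attachS r v o i k : attachable r o ->
  covers (attach (r, (v, o))) (lift ord0 i) (lift ord0 k) = covers r i k.
Proof.
rewrite /covers attachS !lift0 ltnS.
case: (o =P Some k) => [-> /= /eqP->//|_ _].
by case: (r k) => [[j|]|] //=; rewrite /bump /= !add1n ltnS.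
Qed.

Lemma target_attach0 r v o : target (attach (r, (v, o))) ord0 = omap (lift ord0) o.
Proof.
rewrite /target pick_lift0 ?link_attach0 //; congr omap.
case: pickP => [k|no]; first by rewrite link_attach0S => /eqP->.
by case: o no => // l /(_ l); rewrite link_attach0S eqxx.
Qed.

Lemma target_attachS r v o i : attachable r o ->
  target (attach (r, (v, o))) (lift ord0 i) = omap (lift ord0) (target r i).
Proof.
move=> ok; rewrite /target pick_lift0 ?link_attach0 //; congr omap.
by apply: eq_pick => k; rewrite /= link_attachS.
Qed.

Lemma covers0 c i : covers c i ord0 = false.
Proof. by rewrite /covers ltn0. Qed.

Variables (R : comNzRingType) (a d : nat -> nat -> R) (b e : nat -> R).
Let vw m (g : diagram m) i := vertex_weight a d b e g i.

(** Nothing that the other vertices see changes: an arc from the first vertex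
    passes over them exactly when the dangling arc that it replaces did. *)
Lemma vertex_weight_attachS r v o i : attachable r o ->
  vw (attach (r, (v, o))) (lift ord0 i) = vw r i.
Proof.
move=> ok; rewrite /vw /vertex_weight target_attachS // attachS.
have S1 : coverings (attach (r, (v, o))) (lift ord0 i) = coverings r i.
  rewrite /coverings big_ord_recl covers0 add0n.
  by apply: eq_bigr => k _; rewrite covers_attachS.
have S2 l : crossings (attach (r, (v, o))) (lift ord0 i) (lift ord0 l)
    = crossings r i l.
  rewrite /crossings big_ord_recl covers0 add0n.
  by apply: eq_bigr => k _; rewrite covers_attachS // !lift0 ltnS.
have S3 l : nestings (attach (r, (v, o))) (lift ord0 i) (lift ord0 l)
    = nestings r i l.
  rewrite /nestings big_ord_recl covers0 add0n.
  by apply: eq_bigr => k _; rewrite covers_attachS // !lift0 ltnS.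
by case: (target r i) => [l|] /=; rewrite ?S1 ?S2 ?S3;
  case: (o =P Some i) ok => [-> /= /eqP->|_ _] //; case: (r i).
Qed.

Definition below r l := (\sum_(k < n) (dangling r k && (k < l)%N))%N.
Definition above r l := (\sum_(k < n) (dangling r k && (l < k)%N))%N.

(** The arcs over the first vertex are the dangling ones, apart from the one
    that the vertex takes as its own. *)
Lemma vertex_weight_attach0 r v o :
  vw (attach (r, (v, o))) ord0 =
  match v, o with
  | false, Some l => a (below r l) (above r l)
  | true, None => b (ndangling r)
  | true, Some l => d (below r l) (above r l)
  | false, None => e (ndangling r)
  end.
Proof.
rewrite /vw /vertex_weight target_attach0 attach0.
have S1 : coverings (attach (r, (v, None))) ord0 = ndangling r.
  rewrite /coverings big_ord_recl covers0 add0n.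
  by apply: eq_bigr => k _; rewrite covers_attach0 andbT.
have S2 l : crossings (attach (r, (v, Some l))) ord0 (lift ord0 l) = below r l.
  rewrite /crossings big_ord_recl covers0 add0n.
  apply: eq_bigr => k _; rewrite covers_attach0 !lift0 ltnS.
  rewrite (inj_eq Some_inj) -(inj_eq val_inj) -andbA.
  by case: ltngtP; rewrite ?andbF.
have S3 l : nestings (attach (r, (v, Some l))) ord0 (lift ord0 l) = above r l.
  rewrite /nestings big_ord_recl covers0 add0n.
  apply: eq_bigr => k _; rewrite covers_attach0 !lift0 ltnS.
  rewrite (inj_eq Some_inj) -(inj_eq val_inj) -andbA.
  by case: ltngtP; rewrite ?andbF.
by case: v o S1 S2 S3 => [] [l|] /= S1 S2 S3; rewrite ?S1 ?S2 ?S3.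
Qed.

(** The insider and the singleton keep the height h, the opener comes from the
    height h + 1 of the rest, and the closer from the height h - 1. *)
Lemma sum_vertex_weight_attach0 r h :
  \sum_(y : bool * option 'I_n |
        attachable r y.2 && (y.1 + ndangling r == h + (y.2 : bool))%N)
    vw (attach (r, y)) ord0 =
  (if ndangling r == h then star_pred d h + e h else 0)
  + (if ndangling r == h.+1 then star_pred a h.+1 else 0)
  + (if (ndangling r).+1 == h then b (ndangling r) else 0).
Proof.
transitivity (\sum_(v : bool) \sum_(o | attachable r o &&
    (v + ndangling r == h + (o : bool))%N) vw (attach (r, (v, o))) ord0).
  by rewrite pair_big_dep; apply: eq_big => -[].
rewrite big_bool /= !sum_option /= !addn0 !addn1 !add0n !add1n eqSS.
under eq_bigr do rewrite vertex_weight_attach0.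
under [X in _ + (_ + X)]eq_bigr do rewrite vertex_weight_attach0.
rewrite !vertex_weight_attach0.
have starE (x : nat -> nat -> R) (B : bool) :
    \sum_(l | dangling r l && B) x (below r l) (above r l) =
    if B then star_pred x (ndangling r) else 0.
  rewrite -sum_below_above big_mkcondr /=.
  by case: B => //; rewrite big1.
rewrite !starE; case: (ndangling r =P h) => [<-|_];
  by case: (ndangling r =P _.+1) => [<-|_]; ring.
Qed.

Lemma diagram_sumS h :
  diagram_sum a d b e n.+1 h =
  (star_pred d h + e h) * diagram_sum a d b e n h
  + star_pred a h.+1 * diagram_sum a d b e n h.+1
  + (if h is h'.+1 then b h' * diagram_sum a d b e n h' else 0).
Proof.
rewrite /diagram_sum.
rewrite (reindex_onto attach detach) => [|c /andP[vc _]]; last exact: detachK.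
rewrite (eq_bigl (fun x => valid x.1 && (attachable x.1 x.2.2 &&
    (x.2.1 + ndangling x.1 == h + (x.2.2 : bool))%N))); last first.
  move=> -[r [v o]] /=; apply/andP/and3P => [[/andP[vc nc] /eqP cK]|[vc ok nc]].
    have [] := valid_detach vc; rewrite cK /= => vr ok; split=> //.
    by rewrite -(ndangling_attach v ok) eqn_add2r.
  rewrite attachK // valid_attach //; split=> //=.
  by rewrite -(ndangling_attach v ok) eqn_add2r in nc.
rewrite (eq_bigr (fun x => vw (attach x) ord0 * weight a d b e x.1)); last first.
  move=> [r [v o]] /and3P[_ ok _]; rewrite /weight big_ord_recl.
  by congr (_ * _); apply: eq_bigr => i _; apply: vertex_weight_attachS.
transitivity (\sum_(r : diagram n | valid r)
    \sum_(y : bool * option 'I_n | attachable r y.2 &&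
      (y.1 + ndangling r == h + (y.2 : bool))%N)
      vw (attach (r, y)) ord0 * weight a d b e r).
  by rewrite pair_big_dep; apply: eq_big => -[].
under eq_bigr => r _ do
  rewrite -mulr_suml sum_vertex_weight_attach0 !mulrDl.
rewrite !big_split /=; congr (_ + _ + _).
- rewrite mulr_sumr [RHS]big_mkcondr; apply: eq_bigr => r _.
  by case: eqP; rewrite ?mul0r.
- rewrite mulr_sumr [RHS]big_mkcondr; apply: eq_bigr => r _.
  by case: eqP; rewrite ?mul0r.
case: h => [|h]; first by rewrite big1 // => r _; rewrite mul0r.
rewrite mulr_sumr [RHS]big_mkcondr; apply: eq_bigr => r _.
by rewrite eqSS; case: eqP => [->|]; rewrite ?mul0r.
Qed.

End Attach.

Section Sum.
Variables (R : comNzRingType) (a d : nat -> nat -> R) (b e : nat -> R).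

Lemma diagram_sum0 h : diagram_sum a d b e 0 h = (h == 0%N)%:R.
Proof.
have dE (c : diagram 0) : c = [ffun=> None] by apply/ffunP => -[].
rewrite /diagram_sum; case: h => [|h].
  rewrite (big_pred1 [ffun=> None]) => [|c]; first by rewrite /weight big_ord0.
  rewrite [c]dE /= eqxx /ndangling big_ord0 eqxx andbT.
  by apply/validP; split=> -[].
by rewrite big_pred0 // => c; rewrite /ndangling big_ord0 andbF.
Qed.

Lemma diagram_sum_motzkin n h : diagram_sum a d b e n h =
  motzkin (fun m => star_pred d m + e m) (fun m => star_pred a m.+1) b 0 n h.
Proof.
elim: n h => [|n IHn] h; first exact: diagram_sum0.
by rewrite diagram_sumS !IHn; case: h => [|h] //=; rewrite !add0n IHn.
Qed.
End Sum.

(** * From diagrams to set partitions *)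

Section BlockRoot.
Variables (n : nat) (c : diagram n).
Hypothesis c_valid : valid c.
Implicit Types i j k l : 'I_n.

Let link_lt i k : link c i k -> (i < k)%N.
Proof. by have /validP[+ _] := c_valid; apply. Qed.

Let link_inj i k l : link c i k -> link c i l -> k = l.
Proof. by have /validP[_ +] := c_valid; apply. Qed.

Lemma link_fun i j k : link c i k -> link c j k -> i = j.
Proof. by move=> /eqP ck; rewrite /link ck => /eqP[]. Qed.

(** A vertex that no link enters stays in place, so that n iterations lead from
    any vertex to the least element of its block. *)
Definition parent i := if c i is Some (Some j) then j else i.
Definition block_root i := iter n parent i.

Lemma parent_link i k : link c i k -> parent k = i.
Proof. by rewrite /parent => /eqP->. Qed.

Variant parent_spec i : 'I_n -> Prop :=
  | ParentRoot of (forall j, ~~ link c j i) : parent_spec i i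
  | ParentArc j of link c j i : parent_spec i j.

Lemma parentP i : parent_spec i (parent i).
Proof.
rewrite /parent; case ci: (c i) => [[j|]|]; first by right; rewrite /link ci.
  by left=> j; rewrite /link ci.
by left=> j; rewrite /link ci.
Qed.

Lemma parent_no_link k : (forall i, ~~ link c i k) -> parent k = k.
Proof. by move=> no; case: parentP => // i ik; have := no i; rewrite ik. Qed.

Lemma parent_le i : (parent i <= i)%N.
Proof. by case: parentP => // j /link_lt/ltnW. Qed.

Lemma block_root_le i : (block_root i <= i)%N.
Proof.
suff le m : (iter m parent i <= i)%N by apply: le.
elim: m => //= m; exact: leq_trans (parent_le _).
Qed.

Lemma parent_root i : parent (block_root i) = block_root i.
Proof.
suff stable m (j : 'I_n) : (j <= m)%N -> parent (iter m parent j) = iter m parent j.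
  exact/stable/ltnW.
elim: m j => [|m IHm] j lejm /=.
  by case: parentP => // k /link_lt; rewrite ltnNge (leq_trans lejm).
rewrite -iterS iterSr; case: (parentP j) => [no|k /link_lt ltkj]; last first.
  by apply: IHm; rewrite -ltnS (leq_trans ltkj).
by rewrite iter_fix parent_no_link.
Qed.

Lemma block_root_link i k : link c i k -> block_root i = block_root k.
Proof.
move=> /parent_link <-; rewrite /block_root -iterSr /= -/(block_root k).
exact: parent_root.
Qed.

Lemma block_root_no_link k : (forall i, ~~ link c i k) -> block_root k = k.
Proof. by move=> no; apply/iter_fix/parent_no_link. Qed.

(** Let j be the parent of k; j exists since the root of k is at most i < k.  If
    j lies after i, induction applies to i and j.  If it lies before i, induction
    on j and i gives a link from j that ends at i or before, while the only link
    from j ends at k. *)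
Lemma link_from i k : (i < k)%N -> block_root i = block_root k ->
  exists2 l : 'I_n, (l <= k)%N & link c i l.
Proof.
move Es: (i + k)%N => s; elim/ltn_ind: s i k Es => s IHs i k Es ltik eqik.
have [no|j jk] := parentP k.
  by have := block_root_le i; rewrite eqik block_root_no_link // leqNgt ltik.
have ltjk := link_lt jk; have rj := block_root_link jk.
have [ltij|ltji|eqij] := ltngtP i j.
- have [||||l lel il] := IHs (i + j)%N _ i j; rewrite ?rj // -?Es ?ltn_add2l //.
  by exists l => //; apply: leq_trans lel (ltnW ltjk).
- have [||||l lel jl] := IHs (j + i)%N _ j i; rewrite ?rj // -?Es; first by lia.
  by rewrite -(link_inj jk jl) leqNgt ltik in lel.
by exists k => //; rewrite (val_inj eqij).
Qed.

Lemma link_to i k : (i < k)%N -> block_root i = block_root k ->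
  exists2 j : 'I_n, (i <= j)%N & link c j k.
Proof.
move=> ltik eqik; have [no|j jk] := parentP k.
  by have := block_root_le i; rewrite eqik block_root_no_link // leqNgt ltik.
exists j => //; rewrite leqNgt; apply/negP=> ltji.
have [|l lel jl] := link_from ltji; first by rewrite eqik (block_root_link jk).
by rewrite -(link_inj jk jl) leqNgt ltik in lel.
Qed.

End BlockRoot.

Definition partition_of n (c : diagram n) :=
  preim_partition (block_root c) [set: 'I_n].
Definition diagram_of n (P : {set {set 'I_n}}) : diagram n :=
  [ffun k => omap Some [pick i | edge P i k]].

Section Blocks.
Variables (n : nat) (P : {set {set 'I_n}}).
Hypothesis partP : partition P [set: 'I_n].
Implicit Types i j k l : 'I_n.

Let tiP : trivIset P. Proof. by case/and3P: partP. Qed.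

Lemma mem_block i : i \in pblock P i.
Proof. by rewrite mem_pblock (cover_partition partP). Qed.

(** The block of i is the only one that contains i, which removes the quantifier
    over blocks from the definitions of edges and of the kinds of vertices. *)
Lemma exists_block i (Q : pred {set 'I_n}) :
  [exists B in P, (i \in B) && Q B] = Q (pblock P i).
Proof.
apply/exists_inP/idP => [[B BP /andP[iB]]|QB].
  by rewrite (def_pblock tiP BP iB).
by exists (pblock P i); rewrite ?mem_block // pblock_mem // (cover_partition partP).
Qed.

Lemma edgeE i k : edge P i k = [&& k \in pblock P i, (i < k)%N &
  [forall m in pblock P i, ~~ ((i < m)%N && (m < k)%N)]].
Proof. exact: (exists_block i (fun B => [&& k \in B, (i < k)%N & _])). Qed.

Lemma edge_lt i k : edge P i k -> (i < k)%N.
Proof. by rewrite edgeE => /and3P[]. Qed.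

Lemma edge_block i k : edge P i k -> pblock P i = pblock P k.
Proof. by rewrite edgeE => /and3P[ki _ _]; rewrite (same_pblock tiP ki). Qed.

Lemma edge_consecutive i k m :
  edge P i k -> m \in pblock P k -> (i < m)%N -> (m < k)%N -> False.
Proof.
move=> ik; rewrite -(edge_block ik); move: ik.
rewrite edgeE => /and3P[_ _ /forall_inP no] mi im mk.
by have := no m mi; rewrite im mk.
Qed.

Lemma edge_injr i k l : edge P i k -> edge P i l -> k = l.
Proof.
move=> ik il; have eqB : pblock P k = pblock P l.
  by rewrite -(edge_block ik) (edge_block il).
have [lt|lt|/val_inj//] := ltngtP k l.
  by case: (edge_consecutive il _ (edge_lt ik) lt); rewrite -eqB mem_block.
by case: (edge_consecutive ik _ (edge_lt il) lt); rewrite eqB mem_block.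
Qed.

Lemma edge_injl i j k : edge P i k -> edge P j k -> i = j.
Proof.
move=> ik jk; have [lt|lt|/val_inj//] := ltngtP i j.
  by case: (edge_consecutive ik _ lt (edge_lt jk)); rewrite -(edge_block jk) mem_block.
by case: (edge_consecutive jk _ lt (edge_lt ik)); rewrite -(edge_block ik) mem_block.
Qed.

Lemma edge_to k m : m \in pblock P k -> (m < k)%N -> exists i, edge P i k.
Proof.
move=> mk ltmk.
case: (@arg_maxnP _ m (fun i => (i \in pblock P k) && (i < k)%N) (@nat_of_ord n)).
  by rewrite mk.
move=> i /andP[ik ltik] imax; exists i.
rewrite edgeE (same_pblock tiP ik) mem_block ltik /=; apply/forall_inP => j jk.
apply/negP => /andP[ltij ltjk].
by have := imax j; rewrite jk ltjk /= leqNgt ltij => /(_ isT).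
Qed.

Lemma edge_from i m : m \in pblock P i -> (i < m)%N -> exists k, edge P i k.
Proof.
move=> mi ltim.
case: (@arg_minnP _ m (fun k => (k \in pblock P i) && (i < k)%N) (@nat_of_ord n)).
  by rewrite mi.
move=> k /andP[ki ltik] kmin; exists k.
rewrite edgeE ki ltik /=; apply/forall_inP => j ji.
apply/negP => /andP[ltij ltjk].
by have := kmin j; rewrite ji ltij /= leqNgt ltjk => /(_ isT).
Qed.

Lemma link_diagram_of i k : link (diagram_of P) i k = edge P i k.
Proof.
rewrite /link ffunE; case: pickP => [j jk|-> //] /=.
by apply/eqP/idP => [[<-]//|ik]; rewrite (edge_injl ik jk).
Qed.

Lemma dangling_diagram_of k : dangling (diagram_of P) k = false.
Proof. by rewrite /dangling ffunE; case: pickP. Qed.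

Lemma valid_diagram_of : valid (diagram_of P).
Proof.
apply/validP; split=> [i k|i k l]; rewrite !link_diagram_of; first exact: edge_lt.
exact: edge_injr.
Qed.

Lemma ndangling_diagram_of : ndangling (diagram_of P) = 0%N.
Proof. by apply: big1 => k _; rewrite dangling_diagram_of. Qed.

Lemma block_root_diagram_of_block i : block_root (diagram_of P) i \in pblock P i.
Proof.
suff mem m : iter m (parent (diagram_of P)) i \in pblock P i by apply: mem.
elim: m => [|m IHm] /=; first exact: mem_block.
case: parentP => // j; rewrite link_diagram_of => /edge_block eqB.
by rewrite -(same_pblock tiP IHm) -eqB mem_block.
Qed.

Lemma block_root_diagram_of_min i m :
  m \in pblock P i -> (block_root (diagram_of P) i <= m)%N.
Proof.
move=> mi; rewrite leqNgt; apply/negP.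
rewrite -(same_pblock tiP (block_root_diagram_of_block i)) in mi.
move=> /(edge_to mi)[j]; rewrite -link_diagram_of => jr.
have := parent_root valid_diagram_of i; rewrite (parent_link jr) => jE.
by have /validP[lt _] := valid_diagram_of; have := lt _ _ jr; rewrite jE ltnn.
Qed.

(** The root of a vertex is the least element of its block, so two vertices have
    the same root exactly when they share their block. *)
Lemma diagram_ofK : partition_of (diagram_of P) = P.
Proof.
rewrite -[RHS](equivalence_partition_pblock partP).
apply: eq_imset => x; apply/setP=> y; rewrite !inE /=.
apply/eqP/idP => [eqxy|yx].
  rewrite -(same_pblock tiP (block_root_diagram_of_block x)) eqxy.
  by rewrite (same_pblock tiP (block_root_diagram_of_block y)) mem_block.
apply: val_inj; apply/eqP; rewrite eqn_leq.
rewrite !block_root_diagram_of_min // -?(same_pblock tiP yx)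
  ?block_root_diagram_of_block //.
by rewrite (same_pblock tiP yx) block_root_diagram_of_block.
Qed.

End Blocks.

(** By [link_to], every vertex before k in the block of k lies at or before the
    start of the link into k; so this link starts at the element that precedes k
    in the block. *)
Lemma edge_partition_of n (c : diagram n) i k :
  valid c -> edge (partition_of c) i k = link c i k.
Proof.
move=> vc; have /validP[lt _] := vc.
have pbE x y :
    (y \in pblock (partition_of c) x) = (block_root c x == block_root c y).
  rewrite pblock_equivalence_partition ?inE // => u v w _ _ _.
  by split=> // /eqP->.
rewrite edgeE ?preim_partitionP //; apply/and3P/idP.
  rewrite pbE => -[/eqP eqr ltik /forall_inP no].
  have [j lej jk] := link_to vc ltik eqr.
  have [eqij|neq] := eqVneq i j; first by rewrite eqij.
  have := no j; rewrite pbE (block_root_link vc jk) eqr eqxx (lt _ _ jk) => /(_ isT).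
  by rewrite ltn_neqAle lej neq.
move=> ik; rewrite pbE (block_root_link vc ik) eqxx (lt _ _ ik); split=> //.
apply/forall_inP=> m; rewrite pbE (block_root_link vc ik) => /eqP rm.
apply/negP=> /andP[ltim ltmk].
have [j lej jk] := link_to vc ltmk (esym rm).
by rewrite (link_fun jk ik) leqNgt ltim in lej.
Qed.

Lemma partition_ofK n (c : diagram n) :
  valid c -> ndangling c = 0%N -> diagram_of (partition_of c) = c.
Proof.
move=> vc /eqP; rewrite sum_nat_eq0 => /forallP no.
apply/ffunP=> k; rewrite ffunE; case: pickP => [i|none] /=.
  by rewrite edge_partition_of // => /eqP.
have := no k; rewrite /dangling; case ck: (c k) => [[i|]|] //.
by have := none i; rewrite edge_partition_of // /link ck eqxx.
Qed.

(** * Statistics of the vertices of a set partition *)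

Lemma card_pairs (I J : finType) (F : I -> J -> bool) :
  #|[set x : I * J | let: (i, j) := x in F i j]| = (\sum_j \sum_i F i j)%N.
Proof.
rewrite exchange_big pair_bigA -sum1_card big_mkcond /=.
by apply: eq_bigr => -[i j] _; rewrite inE; case: (F i j).
Qed.

Lemma card_triples (I J K : finType) (F : I -> J -> K -> bool) :
  #|[set x : I * J * K | let: (i, j, k) := x in F i j k]| =
  (\sum_j \sum_k \sum_i F i j k)%N.
Proof.
rewrite (eq_bigr (fun j => \sum_i \sum_k F i j k)%N); last first.
  by move=> j _; exact: exchange_big.
rewrite exchange_big pair_bigA pair_bigA -sum1_card big_mkcond /=.
by apply: eq_bigr => -[[i j] k] _; rewrite inE; case: (F i j k).
Qed.

Section Weights.
Variables (n : nat) (P : {set {set 'I_n}}).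
Hypothesis partP : partition P [set: 'I_n].
Implicit Types i j k l : 'I_n.
Let c := diagram_of P.

(** The left end i of an arc over j is determined by its right end k, so that
    triples and pairs are counted by their right ends. *)
Lemma sum_edge_covers j k :
  (\sum_(i < n) [&& i < j, j < k & edge P i k] = covers c j k)%N.
Proof.
have edgeE i : edge P i k = (c k == Some (Some i)).
  by rewrite -(link_diagram_of partP).
have := dangling_diagram_of P k; rewrite /dangling /covers -/c.
case ck: (c k) => [[i|]|] // _.
  rewrite (bigD1 i) //= edgeE ck eqxx andbT andbC big1 ?addn0 // => m.
  rewrite edgeE ck => /negPf neq.
  by rewrite !(inj_eq Some_inj) eq_sym neq !andbF.
by rewrite big1 ?andbF // => m _; rewrite edgeE ck !andbF.
Qed.

Lemma qne_coverings j : qne P j = coverings c j.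
Proof.
by rewrite /qne card_pairs; apply: eq_bigr => k _; apply: sum_edge_covers.
Qed.

Lemma cr_crossings j l : edge P j l -> cr P j = crossings c j l.
Proof.
move=> jl; rewrite /cr card_triples; apply: eq_bigr => k _.
rewrite (bigD1 l) //= [X in (_ + X)%N]big1 ?addn0; last first.
  move=> m neq; apply: big1 => i _; case jm: (edge P j m); rewrite ?andbF //.
  by rewrite (edge_injr partP jm jl) eqxx in neq.
rewrite -mulnb -sum_edge_covers big_distrl /=; apply: eq_bigr => i _.
by rewrite jl mulnb andbT -!andbA; congr nat_of_bool; do !bool_congr.
Qed.

Lemma ne_nestings j l : edge P j l -> ne P j = nestings c j l.
Proof.
move=> jl; rewrite /ne card_triples exchange_big; apply: eq_bigr => k _ /=.
rewrite (bigD1 l) //= [X in (_ + X)%N]big1 ?addn0; last first.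
  move=> m neq; apply: big1 => i _; case jm: (edge P j m); rewrite ?andbF //.
  by rewrite (edge_injr partP jm jl) eqxx in neq.
rewrite -mulnb -sum_edge_covers big_distrl /=; apply: eq_bigr => i _.
rewrite jl mulnb andbT (edge_lt partP jl) /=; congr nat_of_bool.
have [ltlk|] := boolP (l < k)%N; last by rewrite !andbF.
by rewrite (ltn_trans (edge_lt partP jl) ltlk) !andbT.
Qed.

(** The kind of i in the partition, and whether i has a predecessor and a
    successor in the diagram, both depend only on which of these two numbers
    vanish. *)
Definition nbefore i := #|[set j : 'I_n in pblock P i | (j < i)%N]|.
Definition nafter i := #|[set j : 'I_n in pblock P i | (i < j)%N]|.

Lemma card_block i : #|pblock P i| = (nbefore i + nafter i).+1.
Proof.
rewrite (cardsD1 i) (mem_block partP) add1n; congr _.+1.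
rewrite -(cardsID [set j : 'I_n | (j < i)%N]); congr (_ + _)%N; apply: eq_card => j.
  rewrite !inE -(inj_eq val_inj); case: ltngtP; rewrite ?andbF ?andbT //.
by rewrite !inE -(inj_eq val_inj); case: ltngtP; rewrite ?andbF ?andbT.
Qed.

Lemma nbefore_eq0 i : (nbefore i == 0%N) = [forall j in pblock P i, (i <= j)%N].
Proof.
rewrite cards_eq0; apply/eqP/forall_inP => [no j ji|no].
  by rewrite leqNgt; have /setP/(_ j) := no; rewrite !inE ji /= => ->.
by apply/setP=> j; rewrite !inE; case ji: (_ \in _); rewrite //= ltnNge no.
Qed.

Lemma nafter_eq0 i : (nafter i == 0%N) = [forall j in pblock P i, (j <= i)%N].
Proof.
rewrite cards_eq0; apply/eqP/forall_inP => [no j ji|no].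
  by rewrite leqNgt; have /setP/(_ j) := no; rewrite !inE ji /= => ->.
by apply/setP=> j; rewrite !inE; case ji: (_ \in _); rewrite //= ltnNge no.
Qed.

Lemma openerE i : opener P i = (0 < nafter i)%N && (nbefore i == 0%N).
Proof.
rewrite /opener (exists_block partP i
  (fun B => (2 <= #|B|)%N && [forall j in B, (i <= j)%N])) card_block nbefore_eq0.
by rewrite -nbefore_eq0; case: (nbefore i) => [|m] //; rewrite !andbF.
Qed.

Lemma closerE i : closer P i = (0 < nbefore i)%N && (nafter i == 0%N).
Proof.
rewrite /closer (exists_block partP i
  (fun B => (2 <= #|B|)%N && [forall j in B, (j <= i)%N])) card_block -nafter_eq0.
by case: (nafter i) => [|m]; rewrite ?addn0 ?andbF.
Qed.

Lemma insiderE i : insider P i = (0 < nbefore i)%N && (0 < nafter i)%N.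
Proof.
rewrite /insider (exists_block partP i (fun B => (3 <= #|B|)%N)) card_block.
rewrite openerE closerE; case: (nbefore i) (nafter i) => [|p] [|s] //.
by rewrite addSn addnS.
Qed.

Lemma singletonE i : singleton P i = (nbefore i == 0%N) && (nafter i == 0%N).
Proof.
rewrite /singleton (exists_block partP i (fun B => #|B| == 1%N)) card_block.
by rewrite eqSS addn_eq0.
Qed.

Lemma diagram_of_None i : (c i == None) = (nbefore i == 0%N).
Proof.
rewrite nbefore_eq0 ffunE; case: pickP => [j ji|no] /=.
  apply/esym/forall_inP => /(_ j); rewrite -(edge_block partP ji) (mem_block partP).
  by rewrite leqNgt (edge_lt partP ji) => /(_ isT).
apply/esym/forall_inP => j ji; rewrite leqNgt; apply/negP=> lt.
by have [k] := edge_to partP ji lt; rewrite no.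
Qed.

Variant target_spec i : option 'I_n -> bool -> Prop :=
  | TargetNone : target_spec i None true
  | TargetSome l of edge P i l : target_spec i (Some l) false.

Lemma targetP i : target_spec i (target c i) (nafter i == 0%N).
Proof.
rewrite nafter_eq0 /target; case: pickP => [l|no].
  rewrite (link_diagram_of partP) => il.
  rewrite (_ : [forall _ in _, _] = false); first exact: TargetSome.
  apply/forall_inP => /(_ l); rewrite (edge_block partP il) (mem_block partP).
  by rewrite leqNgt (edge_lt partP il) => /(_ isT).
rewrite (_ : [forall _ in _, _] = true); first exact: TargetNone.
apply/forall_inP => j ji; rewrite leqNgt; apply/negP=> lt.
have [k] := edge_from partP ji lt; have := no k.
by rewrite (link_diagram_of partP) => ->.
Qed.

Variables (R : comNzRingType) (a d : nat -> nat -> R) (b e : nat -> R).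

Lemma weight_diagram_of :
  (\prod_(i | opener P i) a (cr P i) (ne P i)) *
  (\prod_(i | closer P i) b (qne P i)) *
  (\prod_(i | insider P i) d (cr P i) (ne P i)) *
  (\prod_(i | singleton P i) e (qne P i)) = weight a d b e c.
Proof.
rewrite big_mkcond (big_mkcond (closer P)) (big_mkcond (insider P)).
rewrite (big_mkcond (singleton P)) -!big_split /=; apply: eq_bigr => i _.
rewrite openerE closerE insiderE singletonE.
rewrite !lt0n -!diagram_of_None /vertex_weight qne_coverings.
case: (targetP i) => [|l il]; last rewrite (cr_crossings il) (ne_nestings il);
  by case: (c i) => [p|]; rewrite /= ?mulr1 ?mul1r.
Qed.

End Weights.

Lemma Bpoly_diagram_sum (R : comNzRingType) (a : nat -> nat -> R) (b : nat -> R)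
    (d : nat -> nat -> R) (e : nat -> R) n :
  Bpoly a b d e n = diagram_sum a d b e n 0.
Proof.
rewrite /Bpoly (reindex_onto (@partition_of n) (@diagram_of n)); last first.
  by move=> P; apply: diagram_ofK.
apply: eq_big => [c|c /andP[partP /eqP cK]].
  apply/andP/andP => [[partP /eqP<-]|[vc /eqP nc]].
    by rewrite valid_diagram_of ?ndangling_diagram_of ?eqxx.
  by rewrite preim_partitionP partition_ofK.
by rewrite weight_diagram_of // cK.
Qed.

Theorem theorem3p9 (R : comNzRingType)
    (a : nat -> nat -> R) (b : nat -> R)
    (d : nat -> nat -> R) (e : nat -> R) :
  is_jfraction
    (fun n => star_pred d n + e n)
    (fun n => star_pred a n * b n.-1)
    (Bpoly a b d e).
Proof.
move=> n; have [K convK] := @motzkin_jfraction R (fun m => star_pred d m + e m)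
  (fun m => star_pred a m.+1) b (fun m => star_pred a m * b m.-1) (fun=> erefl) n.
by exists K => k leKk; rewrite convK // Bpoly_diagram_sum diagram_sum_motzkin.
Qed.
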